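(* Let $\mathscr{Q}$ be a commutative semicartesian quantale and let $f,g:(X,\delta)\to(Y,\delta')$ be functional morphisms of $\mathscr{Q}$-sets. Then the equalizer of $f$ and $g$ in the category $\mathscr{Q}\text{-}\mathbf{Set}$ of $\mathscr{Q}$-sets and functional morphisms is the subset $\{x\in X : f(x)=g(x)\}$, equipped with the restriction of $\delta$ to it.
   Context: A quantale $\mathscr{Q}=(|\mathscr{Q}|,\leq,\otimes)$ is a complete lattice with an associative binary operation $\otimes$ that distributes over arbitrary suprema (including the empty one) in each variable. It is commutative if $\otimes$ is commutative, and semicartesian if $a\otimes b\leq a\wedge b$ for all $a,b$. A $\mathscr{Q}$-set is a set $X$ with a map $\delta:X\times X\to\mathscr{Q}$ such that for all $x,y,z\in X$: (1) $\delta(x,y)=\delta(y,x)$; (2) $\delta(x,y)\otimes\delta(y,z)\leq\delta(x,z)$; (3) $\delta(x,x)\otimes\delta(x,y)=\delta(x,y)$. The extent of $x$ is $\mathrm{E}x=\delta(x,x)$. A functional morphism $f:X\to Y$ of $\mathscr{Q}$-sets is a function between the underlying sets with $\delta_X(x,x')\leq\delta_Y(f(x),f(x'))$ and $\mathrm{E}f(x)=\mathrm{E}x$ for all $x,x'\in X$. $\mathscr{Q}\text{-}\mathbf{Set}$ is the category of $\mathscr{Q}$-sets and functional morphisms. *)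

(* Defs.v *)
From HB Require Import structures.
From mathcomp Require Import all_boot all_order.
From mathcomp Require Import boolp classical_sets.

Set Implicit Arguments.
Unset Strict Implicit.
Unset Printing Implicit Defensive.

Local Open Scope classical_set_scope.

(* The underlying lattice structure is no restriction: a poset
   with suprema of arbitrary subsets has (unique) binary meets and joins, and
   its choice and decidability structures are given by classical logic. *)
HB.mixin Record Lattice_isComplete d T of Order.Lattice d T := {
  qsup : set T -> T;
  qsupP : forall A : set T, supremums A (qsup A)
}.

#[short(type="completeLatticeType")]
HB.structure Definition CompleteLattice d :=
  { T of Lattice_isComplete d T & Order.Lattice d T }.

(* No unit is required; taking A := set0 in the distributivity laws makes the
   bottom element absorbing. *)
HB.mixin Record CompleteLattice_isQuantale d T of CompleteLattice d T := {
  qmul : T -> T -> T;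
  qmulA : associative qmul;
  qmul_supr : forall (a : T) (A : set T),
    qmul a (qsup A) = qsup [set qmul a b | b in A];
  qmul_supl : forall (A : set T) (a : T),
    qmul (qsup A) a = qsup [set qmul b a | b in A]
}.

#[short(type="quantaleType")]
HB.structure Definition Quantale d :=
  { T of CompleteLattice_isQuantale d T & CompleteLattice d T }.

Definition commutative_quantale d (Q : quantaleType d) : Prop :=
  commutative (@qmul d Q).

Definition semicartesian d (Q : quantaleType d) : Prop :=
  forall a b : Q, (qmul a b <= Order.meet a b)%O.

Record QSet d (Q : quantaleType d) : Type := MkQSet {
  qcarrier :> Type;
  delta : qcarrier -> qcarrier -> Q;
  delta_sym : forall x y, delta x y = delta y x;
  delta_trans : forall x y z, (qmul (delta x y) (delta y z) <= delta x z)%O;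
  delta_extent : forall x y, qmul (delta x x) (delta x y) = delta x y
}.

Definition extent d (Q : quantaleType d) (X : QSet Q) (x : X) : Q := delta x x.

Record functional_morphism d (Q : quantaleType d) (X Y : QSet Q) : Type :=
  MkFunctionalMorphism {
  fm_fun :> X -> Y;
  fm_delta : forall x x' : X, (delta x x' <= delta (fm_fun x) (fm_fun x'))%O;
  fm_extent : forall x : X, extent (fm_fun x) = extent x
}.

Record category : Type := MkCategory {
  ob :> Type;
  hom : ob -> ob -> Type;
  idm : forall X, hom X X;
  comp : forall X Y Z, hom Y Z -> hom X Y -> hom X Z;
  comp1m : forall X Y (f : hom X Y), comp (idm Y) f = f;
  compm1 : forall X Y (f : hom X Y), comp f (idm X) = f;
  compA : forall X Y Z W (h : hom Z W) (g : hom Y Z) (f : hom X Y),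
    comp h (comp g f) = comp (comp h g) f
}.

Definition is_equalizer (C : category) (X Y : C) (f g : hom X Y)
    (E : C) (e : hom E X) : Prop :=
  comp f e = comp g e /\
  forall (Z : C) (h : hom Z X), comp f h = comp g h ->
    exists! k : hom Z E, comp e k = h.

Section QSetCategory.
Context d (Q : quantaleType d).

Lemma fm_eq (X Y : QSet Q) (f g : functional_morphism X Y) :
  f =1 g -> f = g.
Proof.
case: f g => [f fd fe] [g gd ge] /= /funext fg.
case: _ / fg gd ge => gd ge.
by rewrite (Prop_irrelevance fd gd) (Prop_irrelevance fe ge).
Qed.

Definition fm_id (X : QSet Q) : functional_morphism X X :=
  @MkFunctionalMorphism d Q X X id (fun _ _ => Order.le_refl _)
    (fun _ => erefl).

Definition fm_comp (X Y Z : QSet Q) (g : functional_morphism Y Z)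
    (f : functional_morphism X Y) : functional_morphism X Z :=
  @MkFunctionalMorphism d Q X Z (fun x => g (f x))
    (fun x x' => Order.le_trans (fm_delta f x x') (fm_delta g (f x) (f x')))
    (fun x => etrans (fm_extent g (f x)) (fm_extent f x)).

Lemma fm_comp1m (X Y : QSet Q) (f : functional_morphism X Y) :
  fm_comp (fm_id Y) f = f.
Proof. exact: fm_eq. Qed.

Lemma fm_compm1 (X Y : QSet Q) (f : functional_morphism X Y) :
  fm_comp f (fm_id X) = f.
Proof. exact: fm_eq. Qed.

Lemma fm_compA (X Y Z W : QSet Q) (h : functional_morphism Z W)
    (g : functional_morphism Y Z) (f : functional_morphism X Y) :
  fm_comp h (fm_comp g f) = fm_comp (fm_comp h g) f.
Proof. exact: fm_eq. Qed.

Definition QSetCat : category :=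
  @MkCategory (QSet Q) (@functional_morphism d Q) fm_id fm_comp
    fm_comp1m fm_compm1 fm_compA.

(* [A : set X] is used as the subtype of the elements of [X] lying in [A]. *)
Definition QSet_restr (X : QSet Q) (A : set X) : QSet Q :=
  @MkQSet d Q A (fun x y => delta (val x) (val y))
    (fun x y => delta_sym (val x) (val y))
    (fun x y z => delta_trans (val x) (val y) (val z))
    (fun x y => delta_extent (val x) (val y)).

Definition restr_incl (X : QSet Q) (A : set X) :
    functional_morphism (QSet_restr A) X :=
  @MkFunctionalMorphism d Q (QSet_restr A) X (fun x : A => val x)
    (fun _ _ => Order.le_refl _) (fun _ => erefl).

End QSetCategory.

(* Main.v *)
Require Import Defs.
From mathcomp Require Import all_boot all_order.
From mathcomp Require Import boolp classical_sets.

Local Open Scope classical_set_scope.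

(** The distance and the extent on a subset are those of the ambient Q-set, so
    a functional morphism that takes its values in the subset factors, as a
    function, through the inclusion, and the factor is again a functional
    morphism ([fm_corestr]). The factor is unique because the inclusion is
    injective, hence a monomorphism ([restr_incl_mono]). A morphism [h]
    satisfies [f \o h = g \o h] exactly when its values lie in the subset where
    [f] and [g] agree, and these facts then give the universal property. *)

(** The corestriction of a functional morphism to a subset [A] that contains
    its image. *)
Definition fm_corestr d (Q : quantaleType d) (X Z : QSet Q) (A : set X)
    (h : functional_morphism Z X) (hA : forall z, A (h z)) :
    functional_morphism Z (QSet_restr A) :=
  @MkFunctionalMorphism d Q Z (QSet_restr A)
    (fun z => exist _ (h z) (mem_set (hA z)))
    (fun z z' => fm_delta h z z') (fun z => fm_extent h z).

Lemma restr_incl_corestr d (Q : quantaleType d) (X Z : QSet Q) (A : set X)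
    (h : functional_morphism Z X) (hA : forall z, A (h z)) :
  fm_comp (restr_incl A) (fm_corestr d Q X Z A h hA) = h.
Proof. exact: fm_eq. Qed.

Lemma restr_incl_mono d (Q : quantaleType d) (X Z : QSet Q) (A : set X)
    (k l : functional_morphism Z (QSet_restr A)) :
  fm_comp (restr_incl A) k = fm_comp (restr_incl A) l -> k = l.
Proof.
move=> kl; apply: fm_eq => z; apply: val_inj.
exact: (congr1 (fun m : functional_morphism Z X => m z) kl).
Qed.

Theorem mainTheorem4 (d : Order.disp_t) (Q : quantaleType d)
    (hcomm : commutative_quantale Q) (hsemi : semicartesian Q)
    (X Y : QSet Q) (f g : functional_morphism X Y) :
  is_equalizer (C := QSetCat Q) f g
    (restr_incl (X := X) [set x : X | f x = g x]).
Proof.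
split=> [|Z h fgh].
  by apply: fm_eq => x; exact: (set_mem (valP x)).
have hA z : [set x : X | f x = g x] (h z).
  exact: (congr1 (fun m : functional_morphism Z Y => m z) fgh).
exists (fm_corestr d Q X Z _ h hA); split; first exact: restr_incl_corestr.
move=> k ek; apply: restr_incl_mono.
by rewrite restr_incl_corestr; exact: esym.
Qed.
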